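(* Let $N\geq 2$, and let $H_1,\ldots,H_s$ be $s\geq 2$ mutually distinct hyperplanes in $\mathbb{P}^N$ (over $\mathbb{C}$). Let $a_1,\ldots,a_s\geq 1$ be real numbers such that $$1-\sum_{j=1}^{s-1}\frac{1}{a_j}>0 \qquad\text{and}\qquad 1-\sum_{j=1}^{s}\frac{1}{a_j}\leq 0.$$ For each $i=1,\ldots,s$ let $$Z_i=\{P_{i,1},\ldots,P_{i,r_i}\}\subset H_i\setminus\bigcup_{j\neq i}H_j$$ be a set of $r_i$ points such that $$\widehat{\alpha}(H_i;Z_i)\geq a_i,$$ and let $Z=\bigcup_{i=1}^s Z_i$. Finally, let $$q:=\left(1-\sum_{j=1}^{s-1}\frac{1}{a_j}\right)\cdot a_s+s-1.$$ Then $$\widehat{\alpha}(\mathbb{P}^N;Z)\geq q.$$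
   Context: The base field is $\mathbb{C}$. For a non-empty finite set of points $Z\subset\mathbb{P}^n$ (with $n\geq 1$), let $I\subset\mathbb{C}[x_0,\ldots,x_n]$ be its saturated (radical) homogeneous ideal. For $m\geq 1$ let $I^{(m)}$ be the $m$-th symbolic power of $I$, i.e. $I^{(m)}=\bigcap_{P\in Z} I(P)^m$, the ideal generated by the forms vanishing to order at least $m$ at every point of $Z$. For a non-zero proper homogeneous ideal $J$ let $\alpha(\mathbb{P}^n;J)=\min\{d: J_d\neq 0\}$ be its initial degree, where $J_d$ is the degree $d$ part of $J$. The Waldschmidt constant of $Z$ is $$\widehat{\alpha}(\mathbb{P}^n;Z)=\widehat{\alpha}(\mathbb{P}^n;I)=\inf_{m\geq 1}\frac{\alpha(\mathbb{P}^n;I^{(m)})}{m}.$$ For a hyperplane $H\subset\mathbb{P}^N$ and a finite set of points $Z\subset H$, $\widehat{\alpha}(H;Z)$ denotes the Waldschmidt constant of $Z$ viewed as a subset of $H\cong\mathbb{P}^{N-1}$ (i.e. with respect to $\mathcal{O}_H(1)$). *)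

(* Defs.v *)
From HB Require Import structures.
From mathcomp Require Import all_boot all_order all_algebra.
From mathcomp Require Import classical_sets cardinality reals.
From mathcomp Require Import complex mpoly.

Set Implicit Arguments.
Unset Strict Implicit.
Unset Printing Implicit Defensive.

Local Open Scope classical_set_scope.
Local Open Scope ring_scope.

(* The real numbers are an arbitrary R : realType, and the complex numbers    *)
(* are R[i].  A linear subspace of P^n is the corresponding vector subspace   *)
(* of C^(n+1): points have vector dimension 1, hyperplanes vector dimension n.*)

Definition ppoint (R : realType) (n : nat) : Type :=
  {U : {vspace 'rV[R[i]]_n.+1} | \dim U == 1%N}.

Definition points_of (R : realType) (n : nat)
    (L : {vspace 'rV[R[i]]_n.+1}) : set (ppoint R n) :=
  [set P | (val P <= L)%VS].

(* I(P): the polynomials vanishing at all homogeneous coordinates of P.  As C *)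
(* is infinite, this is the ideal generated by the forms vanishing at P.      *)
Definition point_ideal (R : realType) (n : nat) (P : ppoint R n) :
    set {mpoly R[i][n.+1]} :=
  [set f | forall v : 'rV[R[i]]_n.+1, v \in val P -> f.@[v ord0] = 0].

Definition ideal_power (A : comNzRingType) (J : set A) (m : nat) : set A :=
  [set f | exists (k : nat) (c : 'I_k -> A) (g : 'I_k -> 'I_m -> A),
     (forall j l, J (g j l)) /\ f = \sum_(j < k) c j * \prod_(l < m) g j l].

(* I^(m), where I is the ideal of Z *)
Definition symbolic_power (R : realType) (n : nat) (Z : set (ppoint R n))
    (m : nat) : set {mpoly R[i][n.+1]} :=
  \bigcap_(P in Z) ideal_power (point_ideal P) m.

Definition graded_part_neq0 (R : realType) (n : nat)
    (J : set {mpoly R[i][n.+1]}) (d : nat) : Prop :=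
  exists f, [/\ J f, f != 0 & f \is d.-homog].

(* alpha(P^n; J); the default value 0 is used only when J contains no nonzero *)
(* form.                                                                      *)
Definition initial_degree (R : realType) (n : nat)
    (J : set {mpoly R[i][n.+1]}) : nat :=
  xget 0%N [set d | graded_part_neq0 J d /\
                    forall e, graded_part_neq0 J e -> (d <= e)%N].

Definition waldschmidt (R : realType) (n : nat) (Z : set (ppoint R n)) : R :=
  inf [set (initial_degree (symbolic_power Z m))%:R / m%:R
      | m in [set m | (1 <= m)%N]].

(* For a hyperplane H of P^n with n >= 1, the linear embedding                *)
(* C^n -> C^(n+1) with image H sending the standard basis to a basis of H; it *)
(* gives an isomorphism P^(n-1) ~ H identifying O(1) with O_H(1).             *)
Definition hyperplane_param (R : realType) (n : nat)
    (H : {vspace 'rV[R[i]]_n.+1}) : 'Hom('rV[R[i]]_n.-1.+1, 'rV[R[i]]_n.+1) :=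
  linfun (mulmxr (\matrix_(k < n.-1.+1) (vbasis H)`_k)).

Definition restrict_points (R : realType) (n : nat)
    (H : {vspace 'rV[R[i]]_n.+1}) (Z : set (ppoint R n)) :
    set (ppoint R n.-1) :=
  [set Q | exists2 P, Z P & val P = (hyperplane_param H @: val Q)%VS].

(* alpha^(H; Z); another choice of basis of H only changes the coordinates on *)
(* P^(n-1) linearly, so the value does not depend on it.                      *)
Definition waldschmidt_in (R : realType) (n : nat)
    (H : {vspace 'rV[R[i]]_n.+1}) (Z : set (ppoint R n)) : R :=
  waldschmidt (restrict_points H Z).

(* Main.v *)
Require Import Defs.
From HB Require Import structures.
From mathcomp Require Import all_boot all_order all_algebra.
From mathcomp Require Import boolp classical_sets cardinality reals.
From mathcomp Require Import complex mpoly.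
From mathcomp Require Import zify.

Set Implicit Arguments.
Unset Strict Implicit.
Unset Printing Implicit Defensive.

Import Order.TTheory GRing.Theory Num.Theory.

Local Open Scope classical_set_scope.
Local Open Scope ring_scope.

(** The theorem is an iterated Bezout argument.  Let F be a non-zero form of
degree d that vanishes to order m_i along each Z_i, and put
c = (1 - sum_(j < s) 1 / a_j) a_s.  The claim is

    sum_(j < s) m_j + c m_s <= d,

proved by induction on d ([weighted_order_le_degree]); with all the m_i equal
to m it reads q m <= d, which is what the Waldschmidt constant requires.

If a_i m_i <= d for every i, then m_j <= d / a_j for j < s and
c m_s <= (1 - sum_(j < s) 1 / a_j) d, and adding up gives the claim.  Otherwise
d < a_i m_i for some i.  The restriction of F to H_i is a form of degree d that
vanishes to order m_i along Z_i, so the bound on the Waldschmidt constant of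
Z_i in H_i forces it to be zero: F = l G, where l is the equation of H_i
([hyperplane_divides]).  The form G has degree d - 1; it vanishes to order
m_i - 1 along Z_i, and still to order m_j along Z_j for j != i because H_i
avoids Z_j.  Passing from F to G lowers d by 1 and the weighted sum by 1 or by
c, and c <= 1 is the hypothesis 1 - sum_(j <= s) 1 / a_j <= 0.

Orders of vanishing are algebraic here: membership in a power of the ideal I(P)
of a point P.  The division steps need to know how an order changes when a
linear factor is cancelled.  For this, let v span P and let e be a linear form
with e(v) = 1, and expand F(e(x) v + t (x - e(x) v)) in powers of t
([expansion]).  This is a ring morphism into polynomials in t, and F lies in
I(P)^m exactly when its expansion is divisible by t^m ([ideal_power_lineP]).
Orders in t are additive over a domain, which gives [ideal_power_line_off] and
[ideal_power_line_on]. *)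

(** * Linear forms and linear substitutions *)

Lemma mpoly_ring_ind (K : comNzRingType) n (Pr : {mpoly K[n]} -> Prop) :
    (forall c, Pr c%:MP) -> (forall i, Pr 'X_i) ->
    (forall p q, Pr p -> Pr q -> Pr (p + q)) ->
    (forall p q, Pr p -> Pr q -> Pr (p * q)) ->
  forall p, Pr p.
Proof.
move=> PrC PrX PrD PrM; elim/mpolyind => [|c m p _ _ IHp].
  by rewrite -(mpolyC0 n K).
apply: PrD => //; rewrite -mul_mpolyC; apply/PrM => //.
rewrite mpolyXE_id; apply: big_ind => [||i _].
- by rewrite -(mpolyC1 n K).
- exact: PrM.
by elim: (m i) => [|k IHk]; [rewrite expr0 -(mpolyC1 n K)
                            | rewrite exprS; apply: PrM].
Qed.

Lemma mpoly_rmorph_eq (K : comNzRingType) n (S : nzRingType)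
    (f g : {rmorphism {mpoly K[n]} -> S}) :
    (forall c, f c%:MP = g c%:MP) -> (forall i, f 'X_i = g 'X_i) -> f =1 g.
Proof.
move=> eqC eqX; elim/mpoly_ring_ind => // p q.
  by rewrite !rmorphD => -> ->.
by rewrite !rmorphM => -> ->.
Qed.

Section LinearForms.
Variable K : comNzRingType.

Definition linform n (c : 'cV[K]_n) : {mpoly K[n]} := \sum_i c i 0 *: 'X_i.

(** The forms to substitute for the variables so as to pull a polynomial back
along the linear map v |-> v A. *)
Definition linsub k n (A : 'M[K]_(k, n)) : n.-tuple {mpoly K[k]} :=
  [tuple linform (col i A) | i < n].

Lemma linform_homog n (c : 'cV[K]_n) : linform c \is 1.-homog.
Proof. by apply: rpred_sum => i _; apply: rpredZ; rewrite dhomogX /= mdeg1. Qed.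

Lemma meval_linform n (c : 'cV[K]_n) (v : 'rV_n) :
  (linform c).@[v ord0] = (v *m c) 0 0.
Proof.
rewrite raddf_sum mxE; apply: eq_bigr => i _ /=.
by rewrite mevalZ mevalXU mulrC.
Qed.

Lemma linform_neq0 n (c : 'cV[K]_n) : c != 0 -> linform c != 0.
Proof.
move=> /cV0Pn[i ci0]; apply/eqP => lc0.
have := meval_linform c (delta_mx 0 i).
by rewrite lc0 meval0 -rowE mxE => /esym/eqP; apply/negP.
Qed.

Lemma mpolyX_linsub k n (A : 'M[K]_(k, n)) i :
  'X_i \mPo linsub A = linform (col i A).
Proof. by rewrite comp_mpolyXU -tnth_nth tnth_mktuple. Qed.

Lemma meval_linsub k n (A : 'M[K]_(k, n)) (p : {mpoly K[n]}) (v : 'rV_k) :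
  (p \mPo linsub A).@[v ord0] = p.@[(v *m A) ord0].
Proof.
rewrite comp_mpoly_meval; apply: meval_eq => i.
by rewrite tnth_mktuple meval_linform !mxE; apply: eq_bigr => j _; rewrite mxE.
Qed.

Lemma linform_linsub k n (A : 'M[K]_(k, n)) (c : 'cV[K]_n) :
  linform c \mPo linsub A = linform (A *m c).
Proof.
rewrite raddf_sum /linform /=.
under eq_bigr => i _ do rewrite comp_mpolyZ mpolyX_linsub scaler_sumr.
rewrite exchange_big; apply: eq_bigr => j _ /=.
rewrite mxE scaler_suml; apply: eq_bigr => i _.
by rewrite scalerA !mxE mulrC.
Qed.

Lemma linsubM l k n (B : 'M[K]_(l, k)) (A : 'M[K]_(k, n)) (p : {mpoly K[n]}) :
  (p \mPo linsub A) \mPo linsub B = p \mPo linsub (B *m A).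
Proof.
pose f : {rmorphism {mpoly K[n]} -> {mpoly K[l]}} :=
  comp_mpoly (linsub B) \o comp_mpoly (linsub A).
pose g : {rmorphism {mpoly K[n]} -> {mpoly K[l]}} :=
  comp_mpoly (linsub (B *m A)).
rewrite -[LHS]/(f p) -[RHS]/(g p).
apply: mpoly_rmorph_eq => [c | i] /=; first by rewrite !comp_mpolyC.
by rewrite !mpolyX_linsub linform_linsub !colE mulmxA.
Qed.

Lemma linsub_homog k n (A : 'M[K]_(k, n)) (p : {mpoly K[n]}) d :
  p \is d.-homog -> p \mPo linsub A \is d.-homog.
Proof.
move=> /dhomogP homp; rewrite comp_mpolyEX big_seq.
apply: rpred_sum => m /homp <-; apply: rpredZ.
rewrite comp_mpolyX /= mdegE.
elim/big_rec2: _ => [|i e q _ homq]; first exact: dhomog1.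
apply: dhomogM => //; rewrite -[X in X.-homog]mul1n.
by apply: dhomogMn; rewrite tnth_mktuple linform_homog.
Qed.

(** If x = x S + l(x) u, then x and x S agree modulo the linear form l, hence so
do the values of any polynomial at x and at x S. *)
Lemma linsub_congr n (c : 'cV[K]_n) (u : 'rV[K]_n) (S : 'M[K]_n)
    (p : {mpoly K[n]}) :
  S + c *m u = 1%:M -> exists q, p = p \mPo linsub S + linform c * q.
Proof.
move=> dec; elim/mpoly_ring_ind: p => [a|i|p1 p2|p1 p2].
- by exists 0; rewrite comp_mpolyC mulr0 addr0.
- exists (u 0 i)%:MP; rewrite mpolyX_linsub mulrC mul_mpolyC.
  rewrite /linform scaler_sumr -big_split /=.
  rewrite (bigD1 i) //= big1 => [|j /negPf jNi].
    rewrite addr0 scalerA -scalerDl.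
    move/matrixP/(_ i i): dec; rewrite !mxE eqxx big_ord1 mulrC => ->.
    by rewrite scale1r.
  rewrite scalerA -scalerDl.
  move/matrixP/(_ j i): dec; rewrite !mxE big_ord1 jNi mulrC => ->.
  by rewrite scale0r.
- move=> [q1 e1] [q2 e2]; exists (q1 + q2).
  by rewrite {1}e1 {1}e2 raddfD /= mulrDr addrACA.
- move=> [q1 e1] [q2 e2].
  exists (q1 * p2 + (p1 \mPo linsub S) * q2).
  rewrite {1}e1 mulrDl {1}e2 rmorphM /= mulrDr -addrA; congr (_ + _).
  by rewrite mulrDr addrC -mulrA; congr (_ + _); apply: mulrCA.
Qed.

End LinearForms.

(** Over a domain, q is the sum of its homogeneous components of degree d - 1:
multiplying by l raises degrees by 1, so l times that sum is the degree d part
of p, which is p. *)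
Lemma homog_factor (K : idomainType) n d (l p q : {mpoly K[n]}) :
    l \is 1.-homog -> p \is d.-homog -> p != 0 -> p = l * q ->
  exists2 e, d = e.+1 & q \is e.-homog.
Proof.
move=> homl homp p0 def_p.
have l0 : l != 0 by apply: contraNneq p0 => l0; rewrite def_p l0 mul0r.
have qE := pihomog_partitionE (leqnn (mmeasure mdeg q)).
have {}qE : q = \sum_(e < mmeasure mdeg q | e.+1 == d) pihomog mdeg e q.
  apply: (mulfI l0); rewrite -def_p -[LHS](pihomog_dE homp) def_p {1}qE.
  rewrite !mulr_sumr raddf_sum [RHS]big_mkcond; apply: eq_bigr => e _ /=.
  have lqe : l * pihomog mdeg e q \is e.+1.-homog.
    by rewrite -add1n; apply: dhomogM => //; apply: pihomogP.
  by case: eqP lqe => [<- /pihomog_dE->|/eqP ? /pihomog_ne0->].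
case: d homp qE => [|e] homp qE.
  by move: p0; rewrite def_p qE big_pred0 ?mulr0 ?eqxx.
exists e => //; rewrite qE.
by apply: rpred_sum => i; rewrite eqSS => /eqP <-; apply: pihomogP.
Qed.

(** * Powers of an ideal *)

Section IdealPower.
Variables (A : comNzRingType) (J : set A).

Lemma ideal_power_gen m (c : A) (g : 'I_m -> A) :
  (forall l, J (g l)) -> ideal_power J m (c * \prod_l g l).
Proof.
move=> Jg; exists 1%N, (fun=> c), (fun=> g); split => //.
by rewrite big_ord1.
Qed.

Lemma ideal_power0 m : ideal_power J m 0.
Proof.
exists 0%N, (fun=> 0), (fun=> fun=> 0); split; first by case.
by rewrite big_ord0.
Qed.

Lemma ideal_powerD m f g :
  ideal_power J m f -> ideal_power J m g -> ideal_power J m (f + g).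
Proof.
move=> [k1 [c1 [g1 [Jg1 ->]]]] [k2 [c2 [g2 [Jg2 ->]]]].
exists (k1 + k2)%N.
exists (fun j => match split j with inl i => c1 i | inr i => c2 i end).
exists (fun j => match split j with inl i => g1 i | inr i => g2 i end).
split=> [j l|]; first by case: (split j).
rewrite big_split_ord /=; congr (_ + _); apply: eq_bigr => j _.
  by rewrite (unsplitK (inl j)).
by rewrite (unsplitK (inr j)).
Qed.

Lemma ideal_power_sum m (I : Type) (r : seq I) (Q : pred I) (F : I -> A) :
    (forall i, Q i -> ideal_power J m (F i)) ->
  ideal_power J m (\sum_(i <- r | Q i) F i).
Proof.
by move=> JF; apply: big_ind => //; [apply: ideal_power0|apply: ideal_powerD].
Qed.

Lemma ideal_power_ind m (Pr : A -> Prop) :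
    Pr 0 -> (forall f g, Pr f -> Pr g -> Pr (f + g)) ->
    (forall c (g : 'I_m -> A), (forall l, J (g l)) -> Pr (c * \prod_l g l)) ->
  forall f, ideal_power J m f -> Pr f.
Proof.
move=> Pr0 PrD Prg f [k [c [g [Jg ->]]]].
by apply: big_ind => // j _; apply: Prg.
Qed.

Lemma ideal_powerM m1 m2 f g :
    ideal_power J m1 f -> ideal_power J m2 g ->
  ideal_power J (m1 + m2) (f * g).
Proof.
move=> Jf; move: g; apply: ideal_power_ind => [|g1 g2|c2 g2 Jg2].
- by rewrite mulr0; apply: ideal_power0.
- by rewrite mulrDr; apply: ideal_powerD.
move: f Jf; apply: ideal_power_ind => [|f1 f2|c1 g1 Jg1].
- by rewrite mul0r; apply: ideal_power0.
- by rewrite mulrDl; apply: ideal_powerD.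
pose g j := match split j with inl i => g1 i | inr i => g2 i end.
have -> : c1 * \prod_l g1 l * (c2 * \prod_l g2 l) = c1 * c2 * \prod_l g l.
  rewrite mulrACA big_split_ord; congr (_ * (_ * _)).
    by apply: eq_bigr => j _; rewrite /g (unsplitK (inl j)).
  by apply: eq_bigr => j _; rewrite /g (unsplitK (inr j)).
by apply: ideal_power_gen => l; rewrite /g; case: (split l).
Qed.

Lemma ideal_power_full f : ideal_power J 0 f.
Proof.
have := @ideal_power_gen 0 f (fun=> 0).
by rewrite big_ord0 mulr1; apply; case.
Qed.

Lemma ideal_power1 f : J f -> ideal_power J 1 f.
Proof.
move=> Jf; have := @ideal_power_gen 1 1 (fun=> f).
by rewrite big_ord1 mul1r; apply.
Qed.

Lemma ideal_power_exp m f : J f -> ideal_power J m (f ^+ m).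
Proof.
move=> Jf; have := @ideal_power_gen m 1 (fun=> f).
by rewrite mul1r prodr_const card_ord; apply.
Qed.

Lemma ideal_power_mull m c f : ideal_power J m f -> ideal_power J m (c * f).
Proof. by move=> Jf; apply: (ideal_powerM (ideal_power_full c) Jf). Qed.

Lemma ideal_power_anti m1 m2 f :
  (m1 <= m2)%N -> ideal_power J m2 f -> ideal_power J m1 f.
Proof.
move=> /subnK <-; move: f; apply: ideal_power_ind => [|f g|c g Jg].
- exact: ideal_power0.
- exact: ideal_powerD.
rewrite big_split_ord mulrA; apply: ideal_power_gen => l; exact: Jg.
Qed.

(** Membership in the Rees algebra of J, a subring of the polynomial ring. *)
Definition rees (p : {poly A}) : Prop := forall k, ideal_power J k p`_k.

Lemma reesD p q : rees p -> rees q -> rees (p + q).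
Proof. by move=> Rp Rq k; rewrite coefD; apply: ideal_powerD. Qed.

Lemma reesM p q : rees p -> rees q -> rees (p * q).
Proof.
move=> Rp Rq k; rewrite coefM; apply: ideal_power_sum => j _.
by rewrite -[X in ideal_power J X](subnKC (leq_ord j)); apply: ideal_powerM.
Qed.

Lemma reesC c : rees c%:P.
Proof.
by case=> [|k]; rewrite coefC; [apply: ideal_power_full|apply: ideal_power0].
Qed.

Lemma reesCX c : J c -> rees (c%:P * 'X).
Proof.
move=> Jc [|[|k]]; rewrite coefMX coefC /=.
- exact: ideal_power0.
- exact: ideal_power1.
- exact: ideal_power0.
Qed.

End IdealPower.

Lemma ideal_power_rmorph (A B : comNzRingType) (J : set A) (J' : set B)
    (phi : {rmorphism A -> B}) m f :
    (forall g, J g -> J' (phi g)) ->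
  ideal_power J m f -> ideal_power J' m (phi f).
Proof.
move=> phiJ; move: f; apply: ideal_power_ind => [|f g|c g Jg].
- by rewrite rmorph0; apply: ideal_power0.
- by rewrite rmorphD; apply: ideal_powerD.
by rewrite rmorphM rmorph_prod; apply: ideal_power_gen => l; apply/phiJ/Jg.
Qed.

(** * Orders of univariate polynomials at 0 *)

Definition order_ge (A : nzRingType) m (p : {poly A}) : Prop :=
  forall k, (k < m)%N -> p`_k = 0.

Lemma order_ge0 (A : nzRingType) m : order_ge m (0 : {poly A}).
Proof. by move=> k _; rewrite coef0. Qed.

Lemma order_geD (A : nzRingType) m (p q : {poly A}) :
  order_ge m p -> order_ge m q -> order_ge m (p + q).
Proof. by move=> op oq k lt_k; rewrite coefD op ?oq ?addr0. Qed.

Lemma order_geM (A : nzRingType) m1 m2 (p q : {poly A}) :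
  order_ge m1 p -> order_ge m2 q -> order_ge (m1 + m2) (p * q).
Proof.
move=> op oq k lt_k; rewrite coefM big1 // => j _.
have [lt_j|le_j] := ltnP j m1; first by rewrite op ?mul0r.
by have := leq_ord j => le_jk; rewrite oq ?mulr0 //; lia.
Qed.

Lemma order_ge_prod (A : nzRingType) m (g : 'I_m -> {poly A}) :
  (forall l, order_ge 1 (g l)) -> order_ge m (\prod_l g l).
Proof.
elim: m g => [|m IHm] g og //.
rewrite big_ord_recl; apply: (@order_geM _ 1 m) => //; exact: IHm.
Qed.

(** Over a domain the lowest coefficients of two factors do not cancel: by
induction on k, the coefficient of degree e + k of p q is p_e q_k. *)
Lemma order_ge_cancel (A : idomainType) e m (p q : {poly A}) :
  order_ge e p -> p`_e != 0 -> order_ge m (p * q) -> order_ge (m - e) q.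
Proof.
move=> op pe0 opq; elim/ltn_ind => k IHk lt_k.
have lt_ek : (e + k < m)%N by lia.
have := opq _ lt_ek; rewrite coefM.
have lt_e : (e < (e + k).+1)%N by rewrite ltnS leq_addr.
rewrite (bigD1 (Ordinal lt_e)) //= big1 => [|j].
  by rewrite addr0 addKn => /eqP; rewrite mulf_eq0 (negPf pe0) => /eqP.
rewrite -val_eqE /= => jNe.
have [lt_j|le_j] := ltnP j e; first by rewrite op ?mul0r.
have := leq_ord j => le_jek.
by rewrite IHk ?mulr0 //; lia.
Qed.

(** * Order of vanishing at a point of projective space *)

Section Expansion.
Variables (K : fieldType) (n : nat) (v : 'rV[K]_n) (e : 'cV[K]_n).

(** The polynomial in t obtained from f by substituting e(x) v + t (x - e(x) v)
for x.  At t = 1 it is f, and when e(v) = 1 the coefficients of the moving part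
x - e(x) v vanish on the line spanned by v. *)
Definition expansion : {mpoly K[n]} -> {poly {mpoly K[n]}} :=
  mmap (polyC \o @mpolyC n K)
    (fun i => (v 0 i *: linform e)%:P + ('X_i - v 0 i *: linform e)%:P * 'X).

HB.instance Definition _ := GRing.RMorphism.on expansion.

Lemma expansionC c : expansion c%:MP = c%:MP%:P.
Proof. by rewrite /expansion mmapC. Qed.

Lemma expansionX i : expansion 'X_i =
  (v 0 i *: linform e)%:P + ('X_i - v 0 i *: linform e)%:P * 'X.
Proof. by rewrite /expansion mmapX mmap1U. Qed.

Lemma horner1_expansion f : (expansion f).[1] = f.
Proof.
rewrite -[LHS]/((horner_eval 1 \o expansion) f) -[RHS]/(idfun f).
apply: mpoly_rmorph_eq => [c|i] /=.
  by rewrite expansionC /horner_eval hornerC.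
by rewrite expansionX /horner_eval hornerD hornerMX !hornerC mulr1 subrKC.
Qed.

Lemma meval_expansion0 f (w : 'rV[K]_n) :
  ((expansion f)`_0).@[w ord0] = f.@[((w *m e) 0 0 *: v) ord0].
Proof.
rewrite -horner_coef0.
rewrite -[LHS]/((meval (w ord0) \o (horner_eval 0 \o expansion)) f).
rewrite -[RHS]/(meval _ f).
apply: mpoly_rmorph_eq => [c|i] /=.
  by rewrite expansionC /horner_eval hornerC !mevalC.
rewrite expansionX /horner_eval hornerD hornerMX !hornerC mulr0 addr0.
rewrite mevalZ meval_linform mevalXU.
by rewrite [RHS]mxE mulrC.
Qed.

End Expansion.

Section LineIdeal.
Variables (K : numFieldType) (n : nat) (v : 'rV[K]_n).

(** The ideal of the point of projective space represented by v. *)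
Definition line_ideal : set {mpoly K[n]} :=
  [set f | forall t : K, f.@[(t *: v) ord0] = 0].

Lemma poly_eq0_horner (p : {poly K}) : (forall t, p.[t] = 0) -> p = 0.
Proof.
move=> p0; apply/eqP; apply: contraT => pN0.
have := max_poly_roots (rs := [seq i%:R | i <- iota 0 (size p)]) pN0.
rewrite size_map size_iota ltnn; apply.
  by apply/allP => t _; rewrite rootE p0.
by rewrite map_inj_uniq ?iota_uniq // => i j /eqP; rewrite eqr_nat => /eqP.
Qed.

(** The constant coefficient of the expansion is f(e(x) v): the univariate
polynomial f(t v), which is zero because all its values are, taken at t = e. *)
Lemma expansion0_eq0 e f : line_ideal f -> (expansion v e f)`_0 = 0.
Proof.
move=> Jf; pose theta := mmap (@polyC K) (fun i : 'I_n => v 0 i *: 'X).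
have -> : (expansion v e f)`_0 = (map_poly (@mpolyC n K) (theta f)).[linform e].
  rewrite -horner_coef0.
  rewrite -[LHS]/((horner_eval 0 \o expansion v e) f).
  rewrite -[RHS]/((horner_eval (linform e) \o
                  (map_poly (@mpolyC n K) \o theta)) f).
  apply: mpoly_rmorph_eq => [c|i] /=.
    by rewrite expansionC /theta mmapC /horner_eval map_polyC !hornerC.
  rewrite expansionX /theta mmapX mmap1U /horner_eval map_polyZ map_polyX.
  by rewrite hornerD hornerMX !hornerC mulr0 addr0 hornerZ hornerX mul_mpolyC.
suff -> : theta f = 0 by rewrite map_poly0 horner0.
apply: poly_eq0_horner => t; rewrite -(Jf t).
rewrite -[LHS]/((horner_eval t \o theta) f).
rewrite -[RHS]/(meval _ f).
apply: mpoly_rmorph_eq => [c|i] /=.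
  by rewrite /theta mmapC /horner_eval hornerC mevalC.
by rewrite /theta mmapX mmap1U /horner_eval hornerZ hornerX mevalXU mxE mulrC.
Qed.

(** The Rees algebra is a ring, so it suffices to look at the expansions of the
variables; there the coefficient of t lies in the ideal since e(v) = 1. *)
Lemma rees_expansion e f : v *m e = 1%:M -> rees line_ideal (expansion v e f).
Proof.
move=> ve1; elim/mpoly_ring_ind: f => [c|i|p q|p q].
- by rewrite expansionC; apply: reesC.
- rewrite expansionX; apply: reesD; first exact: reesC.
  apply: reesCX => t; rewrite mevalB mevalXU mevalZ meval_linform.
  by rewrite -scalemxAl ve1 !mxE mulr1 mulrC subrr.
- by rewrite rmorphD /=; apply: reesD.
- by rewrite rmorphM /=; apply: reesM.
Qed.

(** Expansions of elements of the ideal are divisible by t, hence those of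
elements of its m-th power by t^m.  Conversely f is the sum of the coefficients
of its expansion, the k-th of which lies in the k-th power of the ideal. *)
Lemma ideal_power_lineP e m f : v *m e = 1%:M ->
  ideal_power line_ideal m f <-> order_ge m (expansion v e f).
Proof.
move=> ve1; split.
  move: f; apply: ideal_power_ind => [|f g of_ og|c g Jg].
  - by rewrite rmorph0; apply: order_ge0.
  - by by rewrite rmorphD /=; apply: order_geD.
  - rewrite rmorphM rmorph_prod /=; apply: (@order_geM _ 0 m) => //.
    apply: order_ge_prod => l [|//] _; exact/expansion0_eq0/Jg.
move=> of_; rewrite -[f](horner1_expansion v e) horner_coef.
apply: ideal_power_sum => k _; rewrite expr1n mulr1.
have [lt_k|le_k] := ltnP k m; first by rewrite of_ //; apply: ideal_power0.
exact/(ideal_power_anti le_k)/rees_expansion.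
Qed.

Lemma exists_dual : v != 0 -> exists e : 'cV[K]_n, v *m e = 1%:M.
Proof.
move=> /rV0Pn[i vi0]; exists ((v 0 i)^-1 *: delta_mx i 0).
rewrite -scalemxAr -colE; apply/rowP => j.
by rewrite !mxE !ord1 mulVf.
Qed.

(** The expansion of a factor that does not vanish at v has order 0. *)
Lemma ideal_power_line_off m f g : v != 0 -> f.@[v ord0] != 0 ->
  ideal_power line_ideal m (f * g) -> ideal_power line_ideal m g.
Proof.
move=> /exists_dual[e ve1] fv0; rewrite !(ideal_power_lineP _ _ ve1) rmorphM.
rewrite -[m in X in _ -> X]subn0; apply: order_ge_cancel => //.
apply: contraNneq fv0 => f0.
have := meval_expansion0 v e f v.
by rewrite f0 meval0 ve1 mxE scale1r => <-.
Qed.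

Lemma coef1_expansion_linform e (c : 'cV[K]_n) : v *m c = 0 ->
  (expansion v e (linform c))`_1 = linform c.
Proof.
move=> vc0; rewrite raddf_sum coef_sum /=.
under eq_bigr => i _ do rewrite -mul_mpolyC rmorphM /= expansionC coefCM
  expansionX coefD coefC coefMX coefC /= add0r mul_mpolyC scalerBr scalerA.
rewrite sumrB -scaler_suml [X in X *: _](_ : _ = (v *m c) 0 0).
  by rewrite vc0 mxE scale0r subr0.
by rewrite mxE; apply: eq_bigr => i _; rewrite mulrC.
Qed.

(** The expansion of a linear form through v is t times that form, so it has
order exactly 1. *)
Lemma ideal_power_line_on m (c : 'cV[K]_n) g : v != 0 -> c != 0 ->
    v *m c = 0 ->
  ideal_power line_ideal m (linform c * g) -> ideal_power line_ideal m.-1 g.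
Proof.
move=> /exists_dual[e ve1] c0 vc0; rewrite !(ideal_power_lineP _ _ ve1) rmorphM.
rewrite -subn1; apply: order_ge_cancel => [[|//] _|].
  apply: expansion0_eq0 => t.
  by rewrite meval_linform -scalemxAl vc0 scaler0 mxE.
by rewrite coef1_expansion_linform ?linform_neq0.
Qed.

End LineIdeal.

(** * Hyperplanes *)

Section Hyperplane.
Variables (K : fieldType) (n : nat) (H : {vspace 'rV[K]_n.+1}).
Hypothesis dimH : \dim H = n.

Lemma hyperplane_supplement :
  exists2 u : 'rV[K]_n.+1, u \notin H & (H + <[u]>)%VS = fullv.
Proof.
have dimHC : \dim (H^C)%VS = 1%N.
  by rewrite dimv_compl dimvf dim_matrix dimH mul1r subSnn.
have HC0 : (H^C)%VS != 0%VS by rewrite -dimv_eq0 dimHC.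
have u0 : vpick (H^C)%VS != 0 by rewrite vpick0.
exists (vpick (H^C)%VS).
  apply: contra u0 => uH.
  by rewrite -memv0 -(capv_compl H) memv_cap uH memv_pick.
rewrite -(addv_complf H); congr (_ + _)%VS; apply/eqP.
by rewrite eqEdim -memvE memv_pick dim_vline u0 dimHC.
Qed.

Variables (k : nat) (M : 'M[K]_(k, n.+1)).
Hypothesis memH : forall v : 'rV[K]_n.+1, v \in H <-> exists w, v = w *m M.

(** Take any u outside H.  Then H and u span the space, so every x splits as
(x B) M + (x c) u with coordinates depending linearly on x.  The coefficient
x c vanishes on H because otherwise u would lie in H. *)
Lemma hyperplane_equation :
  exists c : 'cV[K]_n.+1, exists u : 'rV[K]_n.+1, exists B : 'M[K]_(n.+1, k),
  [/\ B *m M + c *m u = 1%:M, c != 0 &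
      forall v, (v \in H) = (v *m c == 0)].
Proof.
have [u uNH Hu] := hyperplane_supplement.
have : row_full (col_mx M u).
  rewrite -sub1mx; apply/row_subP => i.
  have /memv_addP[h /memH[w ->] [_ /vlineP[t ->] ->]] :
    row i 1%:M \in (H + <[u]>)%VS by rewrite Hu memvf.
  rewrite -addsmxE addmx_sub //.
    by rewrite mulmx_sub ?addsmxSl.
  by rewrite scalemx_sub ?addsmxSr.
move=> /row_fullP[D]; rewrite -[D]hsubmxK mul_row_col.
set B := lsubmx D; set c := rsubmx D => decomp.
have rowM w : w *m M \in H by apply/memH; exists w.
have Mc0 : M *m c = 0.
  apply/colP => i; rewrite [RHS]mxE; apply/eqP.
  apply: contraT => Mci; case/negP: uNH.
  suff : (M *m c) i 0 *: u \in H.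
    by move=> /(memvZ ((M *m c) i 0)^-1); rewrite scalerA mulVf ?scale1r.
  rewrite (_ : _ *: u = row i (1%:M - M *m B) *m M) //.
  rewrite -row_mul mulmxBl mul1mx -mulmxA -[X in X - _]mulmx1 -mulmxBr.
  rewrite -decomp [B *m M + _]addrC addrK mulmxA row_mul.
  by rewrite [row i _]mx11_scalar mul_scalar_mx [row _ _ _ _]mxE.
have memHE v : (v \in H) = (v *m c == 0).
  apply/idP/eqP => [/memH[w ->]|vc0]; first by rewrite -mulmxA Mc0 mulmx0.
  rewrite -[v]mulmx1 -decomp mulmxDr [v *m (c *m u)]mulmxA vc0 mul0mx addr0.
  by rewrite mulmxA.
exists c, u, B; split => //.
by apply: contraNneq uNH => c0; rewrite memHE c0 mulmx0.
Qed.

End Hyperplane.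

(** In the splitting x = (x B) M + l(x) u, the polynomial f is congruent modulo
l to its pullback along x |-> (x B) M, which factors through f restricted to
the image of M. *)
Lemma linsub_eq0_factor (K : comNzRingType) n k (M : 'M[K]_(k, n))
    (B : 'M[K]_(n, k)) (c : 'cV[K]_n) (u : 'rV[K]_n) (f : {mpoly K[n]}) :
    B *m M + c *m u = 1%:M -> f \mPo linsub M = 0 ->
  exists g, f = linform c * g.
Proof.
move=> /linsub_congr - /(_ f)[g fE] fM0; exists g.
by rewrite {1}fE -linsubM fM0 comp_mpoly0 add0r.
Qed.

(** * Symbolic powers and Waldschmidt constants *)

Section Projective.
Variable R : realType.

Lemma ppoint_spanned n (P : ppoint R n) :
  exists2 v, v != 0 & val P = <[v]>%VS.
Proof.
have dimP : \dim (val P) = 1%N by apply/eqP/(valP P).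
exists (vpick (val P)); first by rewrite vpick0 -dimv_eq0 dimP.
apply/esym/eqP; rewrite eqEdim -memvE memv_pick dim_vline vpick0.
by rewrite -dimv_eq0 dimP.
Qed.

Lemma point_ideal_line n (P : ppoint R n) v :
  val P = <[v]>%VS -> point_ideal P = line_ideal v.
Proof.
move=> Pv; rewrite predeqE => f; split=> [fP t|fv w].
  by apply: fP; rewrite Pv memvZ ?memv_line.
by rewrite Pv => /vlineP[t ->]; apply: fv.
Qed.

Lemma symbolic_power_exp_linform n (Z : set (ppoint R n)) c m :
    (forall P, Z P -> forall v, v \in val P -> v *m c = 0) ->
  symbolic_power Z m (linform c ^+ m).
Proof.
move=> Zc P ZP; apply: ideal_power_exp => v vP.
by rewrite meval_linform (Zc P) ?mxE.
Qed.

Section Equation.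
Variables (n : nat) (H : {vspace 'rV[R[i]]_n.+1}) (c : 'cV[R[i]]_n.+1).
Hypotheses (c0 : c != 0) (memH : forall v, (v \in H) = (v *m c == 0)).

Lemma symbolic_power_linform_on (Z : set (ppoint R n)) m g :
    Z `<=` points_of H -> symbolic_power Z m (linform c * g) ->
  symbolic_power Z m.-1 g.
Proof.
move=> ZH Jg P ZP; have := Jg P ZP; have := ZH P ZP; rewrite /points_of /=.
have [v v0 Pv] := ppoint_spanned P.
rewrite (point_ideal_line Pv) Pv -memvE memH => /eqP vc0.
exact: ideal_power_line_on.
Qed.

Lemma symbolic_power_linform_off (Z : set (ppoint R n)) m g :
    (forall P, Z P -> ~ points_of H P) ->
    symbolic_power Z m (linform c * g) ->
  symbolic_power Z m g.
Proof.
move=> ZH Jg P ZP; have := Jg P ZP; have := ZH P ZP; rewrite /points_of /=.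
have [v v0 Pv] := ppoint_spanned P.
rewrite (point_ideal_line Pv) Pv -memvE memH => /negP vc0.
apply: ideal_power_line_off => //.
by rewrite meval_linform; apply: contraNneq vc0 => vc0; apply/eqP/rowP => j;
  rewrite !ord1 vc0 mxE.
Qed.

End Equation.

Definition hyperplane_mx n (H : {vspace 'rV[R[i]]_n.+1}) :
  'M[R[i]]_(n.-1.+1, n.+1) := \matrix_(k < n.-1.+1) (vbasis H)`_k.

Lemma hyperplane_paramE n (H : {vspace 'rV[R[i]]_n.+1}) w :
  hyperplane_param H w = w *m hyperplane_mx H.
Proof. by rewrite /hyperplane_param lfunE. Qed.

Lemma mem_hyperplane n (H : {vspace 'rV[R[i]]_n.+1}) v :
    (0 < n)%N -> \dim H = n ->
  v \in H <-> exists w, v = w *m hyperplane_mx H.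
Proof.
move=> n_gt0 dimH; have dimH' : n.-1.+1 = \dim H by rewrite prednK.
split=> [vH|[w ->]].
  exists (\row_k coord (vbasis H) (cast_ord dimH' k) v).
  rewrite mulmx_sum_row {1}(coord_vbasis vH).
  rewrite (reindex (cast_ord dimH')) /=.
    by apply: eq_bigr => k _; rewrite mxE rowK.
  exists (cast_ord (esym dimH')) => k _; first exact: cast_ordK.
  exact: cast_ordKV.
rewrite mulmx_sum_row; apply: rpred_sum => k _; apply: rpredZ.
by rewrite rowK vbasis_mem // mem_nth // size_tuple -dimH'.
Qed.

(** Restriction to H is a ring morphism that maps the ideal of a point of H in
the ambient space into its ideal in H. *)
Lemma symbolic_power_restrict n (H : {vspace 'rV[R[i]]_n.+1})
    (Z : set (ppoint R n)) m f :
    symbolic_power Z m f ->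
  symbolic_power (restrict_points H Z) m (f \mPo linsub (hyperplane_mx H)).
Proof.
move=> Jf Q [P ZP PQ]; apply: ideal_power_rmorph (Jf P ZP) => g Pg w wQ /=.
by rewrite meval_linsub -hyperplane_paramE; apply: Pg; rewrite PQ memv_img.
Qed.

Lemma initial_degree_spec n (J : set {mpoly R[i][n.+1]}) :
    (exists d, graded_part_neq0 J d) ->
  graded_part_neq0 J (initial_degree J) /\
  forall e, graded_part_neq0 J e -> (initial_degree J <= e)%N.
Proof.
move=> exJ; apply: (@xgetPex _ 0%N [set d | graded_part_neq0 J d /\
  forall e, graded_part_neq0 J e -> (d <= e)%N]).
have exJb : exists d, `[< graded_part_neq0 J d >].
  by have [d Jd] := exJ; exists d; apply/asboolP.
case: (ex_minnP exJb) => d /asboolP Jd min_d.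
by exists d; split=> // e Je; apply/min_d/asboolP.
Qed.

Lemma waldschmidt_le n (Z : set (ppoint R n)) m d f :
    symbolic_power Z m f -> f != 0 -> f \is d.-homog ->
  waldschmidt Z * m%:R <= d%:R.
Proof.
case: m => [|m] Jf f0 homf; first by rewrite mulr0.
have Jd : graded_part_neq0 (symbolic_power Z m.+1) d by exists f.
have [_ /(_ _ Jd) le_d] := initial_degree_spec (ex_intro _ d Jd).
rewrite -ler_pdivlMr ?ltr0n //.
apply: (@le_trans _ _ ((initial_degree (symbolic_power Z m.+1))%:R / m.+1%:R)).
  apply: ge_inf; last by exists m.+1.
  by exists 0 => _ [k _ <-]; rewrite divr_ge0.
by rewrite ler_pM2r ?invr_gt0 ?ltr0n // ler_nat.
Qed.

(** The initial degree of an ideal without non-zero forms is 0 by convention, so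
a lower bound also needs the existence of forms in all symbolic powers. *)
Lemma waldschmidt_ge n (Z : set (ppoint R n)) q :
    (forall m, exists d, graded_part_neq0 (symbolic_power Z m) d) ->
    (forall m d f, symbolic_power Z m f -> f != 0 -> f \is d.-homog ->
       q * m%:R <= d%:R) ->
  q <= waldschmidt Z.
Proof.
move=> exJ geq; apply: lb_le_inf; first by eexists; exists 1%N.
move=> _ [m /= m_gt0 <-]; rewrite ler_pdivlMr ?ltr0n //.
by have [[f [Jf f0 homf]] _] := initial_degree_spec (exJ m); apply: geq homf.
Qed.

(** The restriction of f to H would have too small a degree for its order along
Z if it were not zero. *)
Lemma hyperplane_divides n (H : {vspace 'rV[R[i]]_n.+1}) (Z : set (ppoint R n))
    m d f :
    (0 < n)%N -> \dim H = n -> symbolic_power Z m f -> f != 0 ->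
    f \is d.-homog -> d%:R < waldschmidt_in H Z * m%:R ->
  exists l g e,
    [/\ l != 0, forall v, (v \in H) = (v *m l == 0) & f = linform l * g] /\
    [/\ d = e.+1, g != 0 & g \is e.-homog].
Proof.
move=> n_gt0 dimH Jf f0 homf lt_d.
have fH0 : f \mPo linsub (hyperplane_mx H) = 0.
  apply/eqP; apply: contraTT lt_d => fH0; rewrite -leNgt.
  apply: waldschmidt_le fH0 _; first exact: symbolic_power_restrict.
  exact: linsub_homog.
have [l [u [B [decomp l0 memH]]]] :=
  hyperplane_equation dimH (fun v => mem_hyperplane v n_gt0 dimH).
have [g fE] := linsub_eq0_factor decomp fH0.
have [e dE homg] := homog_factor (linform_homog l) homf f0 fE.
exists l, g, e; split=> //; split=> //.
by apply: contraNneq f0 => g0; rewrite fE g0 mulr0.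
Qed.

End Projective.

(** * Hyperplanes with point sets *)

Lemma big_nat_decr (A : numDomainType) (s i : nat) (m : nat -> nat) :
    (1 <= i < s)%N -> (0 < m i)%N ->
  \sum_(1 <= j < s) (m j)%:R =
  \sum_(1 <= j < s) (if j == i then (m j).-1 else m j)%:R + 1 :> A.
Proof.
move=> i_s mi_gt0.
have i_in : i \in index_iota 1 s by rewrite mem_index_iota.
rewrite (bigD1_seq i) ?iota_uniq //= [in RHS](bigD1_seq i) ?iota_uniq //= eqxx.
rewrite [in RHS]addrAC natr1 prednK //; congr (_ + _).
by apply: eq_bigr => j /negPf ->.
Qed.

(** Bounding m_j by d / a_j for j < s and a_s m_s by d, the coefficients of d add
up to 1. *)
Lemma weighted_sum_le (A : realFieldType) (s : nat) (a m : nat -> A) (d : A) :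
    (1 <= s)%N -> (forall i, (1 <= i <= s)%N -> 0 < a i) ->
    0 <= 1 - \sum_(1 <= j < s) 1 / a j ->
    (forall i, (1 <= i <= s)%N -> a i * m i <= d) ->
  \sum_(1 <= j < s) m j + (1 - \sum_(1 <= j < s) 1 / a j) * a s * m s <= d.
Proof.
move=> s_gt0 a_gt0 a_pos le_d.
rewrite -[leRHS](subrK (\sum_(1 <= j < s) 1 / a j * d)) addrC.
apply: lerD.
  rewrite -mulr_suml -[X in _ <= X - _]mul1r -mulrBl -mulrA.
  by apply: ler_wpM2l; rewrite ?le_d ?leqnn ?s_gt0.
rewrite big_nat [leRHS]big_nat; apply: ler_sum => j /andP[j_gt0 /ltnW j_le].
by rewrite mul1r ler_pdivlMl ?a_gt0 ?le_d ?j_gt0.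
Qed.

Section Configuration.
Variables (R : realType) (N s : nat).
Hypotheses (N_gt0 : (0 < N)%N) (s_gt0 : (0 < s)%N).
Variables (H : nat -> {vspace 'rV[R[i]]_N.+1}) (Z : nat -> set (ppoint R N)).
Hypothesis dimH : forall i, (1 <= i <= s)%N -> \dim (H i) = N.
Hypothesis Z_on : forall i, (1 <= i <= s)%N -> Z i `<=` points_of (H i).

(** A witness is the product of the m-th powers of the equations of the
hyperplanes. *)
Lemma symbolic_power_nontrivial m :
  exists d, graded_part_neq0
    (symbolic_power (\bigcup_(i in [set i | (1 <= i <= s)%N]) Z i) m) d.
Proof.
have ex_equation i : exists l : 'cV[R[i]]_N.+1, (1 <= i <= s)%N ->
    l != 0 /\ forall v, (v \in H i) = (v *m l == 0).
  have [i_in|i_out] := boolP (1 <= i <= s)%N; last by exists 0.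
  have [l [_ [_ [_ l0 memH]]]] :=
    hyperplane_equation (dimH i_in)
      (fun v => mem_hyperplane v N_gt0 (dimH i_in)).
  by exists l.
have [l lP] := choice ex_equation.
exists (\sum_(1 <= i < s.+1) (1 * m))%N.
exists (\prod_(1 <= i < s.+1) linform (l i) ^+ m).
have in_s i : (i \in index_iota 1 s.+1) = (1 <= i <= s)%N.
  by rewrite mem_index_iota.
split.
- move=> P [i /= i_in ZP]; rewrite (bigD1_seq i) ?iota_uniq ?in_s //= mulrC.
  apply: ideal_power_mull.
  apply: (symbolic_power_exp_linform (Z := Z i)) => // Q ZQ v vQ.
  have [_ memH] := lP i i_in; apply/eqP; rewrite -memH.
  exact: (subvP (Z_on i_in ZQ)).
- rewrite prodf_seq_neq0; apply/allP => i; rewrite in_s => /lP[l0 _] /=.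
  by rewrite expf_neq0 // linform_neq0.
- elim/big_rec2: _ => [|i p k _ homp]; first exact: dhomog1.
  by apply: dhomogM => //; apply/dhomogMn/linform_homog.
Qed.

Hypothesis Z_off : forall i j, (1 <= i <= s)%N -> (1 <= j <= s)%N -> j != i ->
  forall P, Z j P -> ~ points_of (H i) P.
Variable a : nat -> R.
Hypothesis a_gt0 : forall i, (1 <= i <= s)%N -> 0 < a i.
Hypothesis a_le : forall i, (1 <= i <= s)%N ->
  a i <= waldschmidt_in (H i) (Z i).

Let c := (1 - \sum_(1 <= j < s) 1 / a j) * a s.
Hypothesis sum_le1 : 0 <= 1 - \sum_(1 <= j < s) 1 / a j.
Hypothesis c_le1 : c <= 1.

(** Orders may differ from one Z_i to another: dividing by the equation of H_i
lowers only the order along Z_i. *)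
Lemma weighted_order_le_degree d (m : nat -> nat) f :
    f != 0 -> f \is d.-homog ->
    (forall i, (1 <= i <= s)%N -> symbolic_power (Z i) (m i) f) ->
  \sum_(1 <= j < s) (m j)%:R + c * (m s)%:R <= d%:R.
Proof.
elim/ltn_ind: d m f => d IHd m f f0 homf Jf.
have [le_d|/existsNP[i /not_implyP[i_in /negP]]] :=
    pselect (forall i, (1 <= i <= s)%N -> a i * (m i)%:R <= d%:R).
  exact: (@weighted_sum_le _ s a (fun j => (m j)%:R)).
rewrite -ltNge => lt_d.
have mi_gt0 : (0 < m i)%N.
  by rewrite lt0n; apply: contraTneq lt_d => ->; rewrite mulr0 -leNgt.
have lt_dW : d%:R < waldschmidt_in (H i) (Z i) * (m i)%:R.
  by apply: lt_le_trans lt_d _; apply: ler_wpM2r => //; apply: a_le.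
have [l [g [e [[l0 memH fE] [dE g0 homg]]]]] :=
  hyperplane_divides N_gt0 (dimH i_in) (Jf i i_in) f0 homf lt_dW.
pose m' j := if j == i then (m j).-1 else m j.
have Jg j : (1 <= j <= s)%N -> symbolic_power (Z j) (m' j) g.
  move=> j_in; have := Jf j j_in; rewrite fE /m'; case: eqP => [->|/eqP jNi].
    by apply: (symbolic_power_linform_on l0 memH); apply: Z_on.
  by apply: (symbolic_power_linform_off memH); apply: Z_off.
have {IHd} : \sum_(1 <= j < s) (m' j)%:R + c * (m' s)%:R <= e%:R.
  by apply: IHd homg Jg; rewrite ?dE.
rewrite dE -natr1 -(lerD2r 1); apply: le_trans.
have [iEs|iNs] := eqVneq i s; last first.
  rewrite (@big_nat_decr _ s i m) //; last by lia.
  by rewrite {2}/m' [s == i]eq_sym (negPf iNs) addrAC.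
rewrite iEs in mi_gt0 *.
rewrite -addrA; apply: lerD.
  rewrite big_nat [leRHS]big_nat; apply: ler_sum => j /andP[_ lt_js].
  by rewrite /m' ifF // iEs; apply/negP => /eqP jE; lia.
rewrite /m' iEs eqxx -{1}(prednK mi_gt0) -natr1 mulrDr mulr1.
exact: lerD.
Qed.

End Configuration.

Theorem theorem3p2 (R : realType) (N s : nat) (hN : (2 <= N)%N)
    (hs : (2 <= s)%N)
    (H : nat -> {vspace 'rV[R[i]]_N.+1})
    (H_hyperplane : forall i, (1 <= i <= s)%N -> \dim (H i) = N)
    (H_distinct : forall i j, (1 <= i <= s)%N -> (1 <= j <= s)%N ->
       i != j -> H i != H j)
    (a : nat -> R)
    (a_ge1 : forall i, (1 <= i <= s)%N -> 1 <= a i)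
    (a_pos : 1 - \sum_(1 <= j < s) 1 / a j > 0)
    (a_npos : 1 - \sum_(1 <= j < s.+1) 1 / a j <= 0)
    (Z : nat -> set (ppoint R N))
    (Z_finite : forall i, (1 <= i <= s)%N -> finite_set (Z i))
    (Z_nonempty : forall i, (1 <= i <= s)%N -> Z i !=set0)
    (Z_sub : forall i, (1 <= i <= s)%N ->
       Z i `<=` points_of (H i) `\`
         \bigcup_(j in [set j | (1 <= j <= s)%N /\ j != i]) points_of (H j))
    (Z_waldschmidt : forall i, (1 <= i <= s)%N ->
       waldschmidt_in (H i) (Z i) >= a i) :
  waldschmidt (\bigcup_(i in [set i | (1 <= i <= s)%N]) Z i) >=
    (1 - \sum_(1 <= j < s) 1 / a j) * a s + s%:R - 1.
Proof.
have s_in : (1 <= s <= s)%N by lia.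
have a_gt0 i : (1 <= i <= s)%N -> 0 < a i.
  by move=> /a_ge1; apply: lt_le_trans ltr01.
have Z_on i : (1 <= i <= s)%N -> Z i `<=` points_of (H i).
  by move=> i_in P /(Z_sub i i_in)[].
have Z_off i j : (1 <= i <= s)%N -> (1 <= j <= s)%N -> j != i ->
    forall P, Z j P -> ~ points_of (H i) P.
  move=> i_in j_in jNi P /(Z_sub j j_in)[_ PNH] PH.
  by apply: PNH; exists i => //; split=> //; rewrite eq_sym.
have c_le1 : (1 - \sum_(1 <= j < s) 1 / a j) * a s <= 1.
  rewrite -ler_pdivlMr ?a_gt0 // lerBlDr addrC.
  by move: a_npos; rewrite big_nat_recr ?subr_le0 //; lia.
have N_gt0 : (0 < N)%N by lia.
apply: waldschmidt_ge => [m|m d f Jf f0 homf].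
  exact: (symbolic_power_nontrivial N_gt0 H_hyperplane Z_on m).
apply: le_trans (weighted_order_le_degree N_gt0 _ H_hyperplane Z_on Z_off a_gt0
  Z_waldschmidt (ltW a_pos) c_le1 (m := fun=> m) f0 homf _); last 2 first.
- by lia.
- by move=> i i_in P ZP; apply: Jf; exists i.
rewrite sumr_const_nat -[m%:R *+ (s - 1)]mulr_natl natrB; last by lia.
by rewrite [leRHS]addrC -addrA mulrDl.
Qed.
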